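(* Let $p\in[1,\infty]$ with conjugate $p^*$, $\gamma_{\{1\}}\ge0$, and let $\mathrm{QMC}^{\mathrm{MP}}_{1,n}(f)=\frac1n\sum_{j=1}^nf\big(\frac{2j-1}{2n}\big)$ be the composite midpoint rule. Then \[\mathrm{error}(\mathrm{QMC}^{\mathrm{MP}}_{1,n};\mathcal{F}_1)=\frac{\gamma_{\{1\}}}{2(p^*+1)^{1/p^*}n},\] with the convention $(p^*+1)^{1/p^*}=1$ for $p^*=\infty$. Moreover, \[\mathrm{error}(\mathrm{QMC}^{\mathrm{MP}}_{1,n};\mathcal{F}_1)=\min\{\mathrm{error}(\mathrm{QMC}_{1,k};\mathcal{F}_1): k\le n,\ \mathrm{QMC}_{1,k}\text{ a QMC rule with }k\text{ nodes in }[0,1]\}.\]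
   Context: $1/p+1/p^*=1$. $K(x,t)=t$ if $x\ge t$ and $t-1$ if $x<t$. The one-dimensional weighted ANOVA space $\mathcal{F}_1=\mathcal{F}_{1,p,\boldsymbol\gamma}$ with weights $\gamma_\emptyset,\gamma_{\{1\}}\ge0$ consists of the functions $f=f_\emptyset+f_{\{1\}}$, where $f_\emptyset$ is a constant (present only if $\gamma_\emptyset>0$) and $f_{\{1\}}(x)=\int_0^1h(t)K(x,t)\,\mathrm{d}t$ with $h\in L_p([0,1])$ (present only if $\gamma_{\{1\}}>0$), normed by $(\gamma_\emptyset^{-p}|f_\emptyset|^p+\gamma_{\{1\}}^{-p}\|h\|_{L_p}^p)^{1/p}$ (max version for $p=\infty$; terms with zero weight omitted). A QMC rule with $k$ nodes $x_1,\dots,x_k\in[0,1]$ is $\mathrm{QMC}_{1,k}(f)=\frac1k\sum_{j=1}^kf(x_j)$; worst case error $\mathrm{error}(\mathrm{QMC}_{1,k};\mathcal{F}_1)=\sup_{\|f\|_{\mathcal{F}_1}\le1}|\int_0^1f-\mathrm{QMC}_{1,k}(f)|$. *)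

(* Defs.v *)
From HB Require Import structures.
From mathcomp Require Import all_boot all_order all_algebra.
From mathcomp Require Import all_classical all_reals all_analysis.
Set Implicit Arguments. Unset Strict Implicit. Unset Printing Implicit Defensive.
Import Order.TTheory GRing.Theory Num.Theory.
Import numFieldNormedType.Exports.
Local Open Scope classical_set_scope.
Local Open Scope ring_scope.

Section QMC1.
Variable R : realType.

Definition leb : {measure set (measurableTypeR R) -> \bar R} := @lebesgue_measure R.

Definition mu01 := mrestr leb (measurable_itv `[(0:R), 1]).

Definition Kker (x t : R) : R := if t <= x then t else t - 1.

Definition f1 (h : R -> R) (x : R) : R :=
  \int[leb]_(t in `[(0:R), 1]) (h t * Kker x t).

(* f = f_empty + f_{1}, with f_empty = c constant *)
Definition fF (c : R) (h : R -> R) (x : R) : R := c + f1 h x.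

(* membership of the data (c,h) in F_1: h in L_p([0,1]); components with
   zero weight are absent (i.e. zero) *)
Definition inF1 (p : \bar R) (g0 g1 : R) (c : R) (h : R -> R) : Prop :=
  [/\ measurable_fun setT h,
      finite_norm mu01 p h,
      (g0 = 0 -> c = 0) &
      (g1 = 0 -> forall t, t \in `[(0:R), 1] -> h t = 0)].

(* weighted terms gamma_u^{-1} * norm; omitted (= 0) when the weight is 0 *)
Definition w0 (g0 c : R) : \bar R := if 0 < g0 then (`|c| / g0)%:E else 0%E.
Definition w1 (p : \bar R) (g1 : R) (h : R -> R) : \bar R :=
  if 0 < g1 then ('N[mu01]_p[EFin \o h] * (g1^-1)%:E)%E else 0%E.

Definition normF1 (p : \bar R) (g0 g1 c : R) (h : R -> R) : \bar R :=
  match p with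
  | r%:E => ((w0 g0 c `^ r + w1 p g1 h `^ r) `^ r^-1)%E
  | +oo%E => maxe (w0 g0 c) (w1 p g1 h)
  | -oo%E => 0%E
  end.

Definition QMC (k : nat) (x : 'I_k -> R) (f : R -> R) : R :=
  k%:R^-1 * \sum_(j < k) f (x j).

Definition wce (p : \bar R) (g0 g1 : R) (k : nat) (x : 'I_k -> R) : \bar R :=
  ereal_sup [set e : \bar R | exists (c : R) (h : R -> R),
    [/\ inF1 p g0 g1 c h, (normF1 p g0 g1 c h <= 1)%E &
        e = (`| \int[leb]_(y in `[(0:R), 1]) fF c h y - QMC x (fF c h) |)%:E]].

(* composite midpoint rule nodes (2j-1)/(2n), j = 1..n (here j+1, j : 'I_n) *)
Definition mid_nodes (n : nat) (j : 'I_n) : R := (2 * j%:R + 1) / (2 * n%:R).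

Definition conj_factor (p : \bar R) : R :=
  match hoelder_conjugate p with
  | q%:E => powR (q + 1) q^-1
  | _ => 1
  end.

End QMC1.

(* Main.v *)
Require Import Defs.
From HB Require Import structures.
From mathcomp Require Import all_boot all_order all_algebra.
From mathcomp Require Import all_classical all_reals all_analysis.
From mathcomp Require Import measurable_realfun ess_sup_inf lra ring.
Set Implicit Arguments. Unset Strict Implicit. Unset Printing Implicit Defensive.
Import Order.TTheory GRing.Theory Num.Theory.
Import numFieldNormedType.Exports.
Local Open Scope classical_set_scope.
Local Open Scope ring_scope.

(** For [f = c + f1 h] the integral of [f1 h] over [0,1] vanishes (Fubini), so the
    error of the rule with nodes [x] is [- \int h * disc x], where
    [disc x t = t - #{j | x j < t} / k].  By Hoelder the worst case error is at
    most [g1] times the [L_q] norm of [disc x] ([q] conjugate to [p]), and this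
    norm is computed cell by cell for the midpoint rule.  Conversely, among all
    rules with [k] nodes [|disc x|] is pointwise minimal for the midpoint rule;
    testing with a function of the sign of [disc x] and of a modulus (nearly)
    extremal in Hoelder's inequality for the midpoint rule gives the lower bound
    for every rule, which decreases in [k]. *)

(** * Lebesgue measure restricted to [0,1] *)

Section Restriction.
Variable R : realType.
Local Notation I01 := (`[(0:R), 1]%classic).

Lemma leb01 : leb R I01 = 1%E.
Proof.
have := @lebesgue_measure_itv R `[0, 1]; rewrite /= lte_fin ltr01 => ->.
by rewrite oppr0 adde0.
Qed.

Lemma mu01T : @mu01 R [set: R] = 1%E.
Proof. by rewrite /mu01 /mrestr setTI leb01. Qed.

(** The complement of [0,1] is null for [mu01], and both measures agree on subsets of [0,1]. This
    passes between the norms, taken over the whole line for [mu01], and the errors, which are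
    Lebesgue integrals over [0,1]. *)
Lemma integral_mu01 (f : R -> \bar R) :
  measurable_fun setT f -> (forall x, 0 <= f x)%E ->
  (\int[@mu01 R]_x f x = \int[leb R]_(x in I01) f x)%E.
Proof.
move=> mf f0.
rewrite (@ge0_negligible_integral _ _ _ (@mu01 R) setT (~` I01))//.
- rewrite setTD setCK; apply: eq_measure_integral => A mA AI.
  by rewrite /mu01/= /mrestr (setIidl AI).
- exact: measurableC.
- by rewrite /mu01/= /mrestr setICl measure0.
Qed.

(** Since [mu01] has total mass 1, its L_p space is contained in its L_1 space. *)
Lemma integrable_Lp (p : \bar R) (h : R -> R) : (1 <= p)%E ->
  measurable_fun setT h -> finite_norm (@mu01 R) p h ->
  (leb R).-integrable I01 (EFin \o h).
Proof.
move=> p1 mh fh.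
have : h \in Lfun (@mu01 R) p by apply/andP; split; rewrite inE.
have fT : @mu01 R [set: R] \is a fin_num by rewrite mu01T.
move=> /(@Lfun_subset _ _ _ _ 1 p (lexx _) p1 fT p1).
move=> /Lfun1_integrable /integrableP[_].
rewrite integral_mu01//; last by apply/measurableT_comp => //; exact/measurable_EFinP.
move=> H; apply/integrableP; split => //.
by apply/measurable_EFinP; exact: measurable_funTS.
Qed.

End Restriction.

(** * Integrals of the kernel [Kker] and of [f1] *)

Section ErrorFunctional.
Variable R : realType.
Local Notation I01 := (`[(0:R), 1]%classic).

Lemma integral_indicM (A : set R) (g : R -> R) :
  (\int[leb R]_x (\1_A x * g x)%:E = \int[leb R]_(x in A) (g x)%:E)%E.
Proof.
rewrite [RHS]integral_mkcond; apply: eq_integral => x _.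
by rewrite patchE indicE; case: ifP => _; rewrite ?mul1r ?mul0r.
Qed.

Lemma KkerE (x t : R) : Kker x t = t - (x < t)%R%:R.
Proof. by rewrite /Kker; case: leP => _; rewrite ?subr0. Qed.

Lemma measurable_Kker2 : measurable_fun [set: R * R] (fun z => Kker z.1 z.2).
Proof.
apply: measurable_fun_ifT => //=.
- exact: measurable_fun_ler.
- exact: measurable_funB.
Qed.

Lemma measurable_Kker (x : R) : measurable_fun [set: R] (Kker x).
Proof.
apply: (@measurableT_comp _ _ _ _ _ _ (fun z : R * R => Kker z.1 z.2) _
  (fun t => (x, t))) => //; first exact: measurable_Kker2.
by apply: measurable_fun_pair.
Qed.

Lemma normr_Kker_le1 (x t : R) : t \in `[(0:R), 1] -> `|Kker x t| <= 1.
Proof.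
rewrite in_itv/= => /andP[t0 t1]; rewrite KkerE.
by case: (x < t); rewrite /= ?subr0 ler_norml; apply/andP; split; lra.
Qed.

Lemma integrable_bounded01 (g : R -> R) (M : R) : measurable_fun setT g ->
  (forall t, t \in `[(0:R), 1] -> `|g t| <= M) ->
  (leb R).-integrable I01 (EFin \o g).
Proof.
move=> mg gM; apply: measurable_bounded_integrable => //.
- by rewrite leb01 ltry.
- exact: measurable_funTS.
- exists M; split; first by rewrite num_real.
  by move=> N MN t/= tI; apply: (le_trans (gM _ tI)); exact: ltW.
Qed.

Lemma integrable_mul_bounded (h g : R -> R) (M : R) :
  (leb R).-integrable I01 (EFin \o h) -> measurable_fun setT g ->
  (forall t, t \in `[(0:R), 1] -> `|g t| <= M) ->
  (leb R).-integrable I01 (fun t => (h t * g t)%:E).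
Proof.
move=> ih mg gM.
suff : (leb R).-integrable I01 ((EFin \o h) \* (EFin \o g))%E by [].
apply: integrableMl => //; first exact: measurable_funTS.
exists M; split; first by rewrite num_real.
by move=> N MN t/= tI; apply: (le_trans (gM _ tI)); exact: ltW.
Qed.

Lemma integrable_Kker_dx (t : R) : t \in `[(0:R), 1] ->
  (leb R).-integrable I01 (fun x => (Kker x t)%:E).
Proof.
move=> tI.
suff : (leb R).-integrable I01 (EFin \o (fun x : R => Kker x t)) by [].
apply: (integrable_bounded01 (M := 1)) => [|x _]; last exact: normr_Kker_le1.
exact: (measurable_fun_pair1 t measurable_Kker2).
Qed.

(** The jump term [x < t] integrates to the length [t] of [0,t[, which cancels the integral of the
    constant [t]. *)
Lemma integral_Kker_dx (t : R) : t \in `[(0:R), 1] ->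
  (\int[leb R]_(x in I01) (Kker x t)%:E = 0)%E.
Proof.
rewrite in_itv/= => /andP[t0 t1].
under eq_integral do rewrite KkerE EFinB.
have -> : (\int[leb R]_(x in I01) (t%:E - ((x < t)%R%:R)%:E) =
  \int[leb R]_(x in I01) ((cst t%:E) x - (\1_(`]-oo, t[%classic) x)%:E))%E.
  by apply: eq_integral => x _; rewrite indicE mem_setE in_itv.
rewrite integralB//=; last 2 first.
- by apply: (@integrable_bounded01 (cst t) `|t|).
- apply: (@integrable_bounded01 (\1_(`]-oo, t[%classic)) 1) => [|x _].
    exact: measurable_indic.
  by rewrite indicE; case: (_ \in _); rewrite /= ?normr1 ?normr0.
rewrite integral_cst// leb01 mule1 integral_indic//.
have -> : `]-oo, t[%classic `&` I01 = `[0, t[%classic.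
  apply/seteqP; split => y /=; rewrite !in_itv/=.
    by move=> [-> /andP[-> _]].
  by move=> /andP[-> yt]; rewrite yt; split => //; apply: ltW; exact: lt_le_trans yt t1.
have := @lebesgue_measure_itv R `[0, t[.
rewrite /= lte_fin => ->; case: ltP => [_|t0']; first by rewrite oppr0 adde0 subee.
by rewrite sube0; congr EFin; apply/eqP; rewrite eq_le t0 t0'.
Qed.

(** By Fubini the integral over [x] can be taken first, and there the kernel integrates to 0 for
    each fixed [t]. *)
Lemma f1_integral0 (h : R -> R) : measurable_fun setT h ->
  (leb R).-integrable I01 (EFin \o h) ->
  (leb R).-integrable I01 (EFin \o f1 h) /\ \int[leb R]_(y in I01) f1 h y = 0.
Proof.
move=> mh ih.
(* Cutting off by indicators in both variables makes Fubini applicable on the whole plane. *)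
pose F (z : R * R) : \bar R :=
  ((\1_I01 z.1 * (\1_I01 z.2 * (h z.2 * Kker z.1 z.2)))%R)%:E.
have mI : measurable_fun [set: R] (\1_I01 : R -> R) by exact: measurable_indic.
have mF : measurable_fun setT F.
  apply/measurable_EFinP; apply: measurable_funM; first exact: measurableT_comp.
  apply: measurable_funM; first exact: measurableT_comp.
  apply: measurable_funM; first exact: measurableT_comp.
  exact: measurable_Kker2.
have iF : (lebesgue_measure \x lebesgue_measure)%E.-integrable setT F.
  apply/integrable12ltyP => //.
  pose C := (\int[leb R]_y (\1_I01 y * `|h y|)%:E)%E.
  have Coo : (C < +oo)%E.
    by rewrite /C integral_indicM; case/integrableP : ih.
  have mIh : measurable_fun setT (fun y => (\1_I01 y * `|h y|)%:E).
    apply/measurable_EFinP; apply: measurable_funM => //.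
    exact: measurableT_comp.
  have C0 : (0 <= C)%E.
    by apply: integral_ge0 => y _; rewrite lee_fin mulr_ge0.
  (* As the kernel is bounded by 1 on [0,1], each inner integral is at most the L_1 norm [C] of [h]
     on [0,1]. *)
  apply: (@le_lt_trans _ _ (\int[leb R]_x ((\1_I01 x)%:E * C))%E); last first.
    rewrite ge0_integralZr//; last exact/measurable_EFinP.
    rewrite integral_indic// setIT.
    by rewrite leb01 mul1e.
  apply: ge0_le_integral => //.
  - by move=> x _; exact: integral_ge0.
  - have mFa : measurable_fun setT (abse \o F) by exact: measurableT_comp.
    refine (measurable_fun_fubini_tonelli_F (m2 := lebesgue_measure) _ mFa _).
    by move=> z /=.
  - apply: emeasurable_funM; [exact/measurable_EFinP|exact: measurable_cst].
  move=> x _; rewrite /C -ge0_integralZl//.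
  apply: ge0_le_integral => //.
  - apply: measurableT_comp => //.
    exact: (measurable_fun_pair2 x mF).
  - by apply: emeasurable_funM.
  move=> y _; rewrite -EFinM lee_fin /= normrM ger0_norm// ler_wpM2l//.
  rewrite normrM ger0_norm// !indicE mem_setE.
  case: (boolP (y \in `[0, 1])) => yI; last by rewrite !mul0r.
  by rewrite !mul1r normrM ler_piMr// normr_Kker_le1.
have F1 : fubini_F lebesgue_measure F = (EFin \o f1 h) \_ I01.
  apply/funext => x; rewrite patchE /fubini_F /F/= [\1__ x]indicE.
  case: ifP => xI; last first.
    by apply: integral0_eq => y _; rewrite mul0r.
  under eq_integral do rewrite mul1r.
  rewrite integral_indicM /f1 /Rintegral fineK//.
  apply: integrable_fin_num => //.
  by apply: (integrable_mul_bounded ih (measurable_Kker x)) => t; exact: normr_Kker_le1.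
split.
  apply/integrable_mkcond => //; rewrite -F1.
  exact: integrable_fubini_F.
rewrite /Rintegral.
transitivity (fine (\int[leb R]_x ((EFin \o f1 h) \_ I01) x)%E).
  by congr fine; rewrite -integral_mkcond.
rewrite -F1 (Fubini iF).
rewrite integral0_eq// => t _.
rewrite /F /= integral_indicM indicE mem_setE.
case: (boolP (t \in `[0, 1])) => tI; last first.
  by apply: integral0_eq => x _; rewrite mul0r.
under eq_integral do rewrite mul1r EFinM.
have iK := integrable_Kker_dx tI.
by rewrite integralZl// integral_Kker_dx// mule0.
Qed.

End ErrorFunctional.

(** * The discrepancy function of a rule *)

Section Discrepancy.
Variable R : realType.
Local Notation I01 := (`[(0:R), 1]%classic).

(** Kept as an average of kernels, so that measurability and the bound 1 come from [Kker] and the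
    sum over the nodes passes under the integral; [discE] is the counting form. *)
Definition disc k (x : 'I_k -> R) (t : R) : R :=
  k%:R^-1 * \sum_(j < k) Kker (x j) t.

Lemma measurable_sum_Kker k (x : 'I_k -> R) :
  measurable_fun setT (fun t => \sum_(j < k) Kker (x j) t).
Proof. by apply: measurable_sum => j; exact: measurable_Kker. Qed.

Lemma normr_sum_Kker_le k (x : 'I_k -> R) (t : R) : t \in `[(0:R), 1] ->
  `|\sum_(j < k) Kker (x j) t| <= k%:R.
Proof.
move=> tI; rewrite (le_trans (ler_norm_sum _ _ _))//.
rewrite (le_trans (ler_sum _ (fun j _ => normr_Kker_le1 (x j) tI)))//.
by rewrite sumr_const card_ord.
Qed.

Lemma measurable_disc k (x : 'I_k -> R) : measurable_fun setT (disc x).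
Proof.
apply: measurable_funM => //.
exact: measurable_sum_Kker.
Qed.

Lemma normr_disc_le1 k (x : 'I_k -> R) (t : R) : t \in `[(0:R), 1] ->
  `|disc x t| <= 1.
Proof.
move=> tI; rewrite /disc normrM ger0_norm ?invr_ge0//.
case: k x => [|k] x; first by rewrite big_ord0 normr0 mulr0.
by rewrite ler_pdivrMl ?ltr0n// mulr1 normr_sum_Kker_le.
Qed.

(** The terms [t] average to [t] only over a nonempty set of nodes: for [k = 0] the left side is
    0. *)
Lemma discE k (x : 'I_k -> R) (t : R) : (0 < k)%N ->
  disc x t = t - (\sum_(j < k) (x j < t)%R)%N%:R / k%:R.
Proof.
move=> k0; rewrite /disc; under eq_bigr do rewrite KkerE.
rewrite sumrB sumr_const card_ord -natr_sum mulrBr [_ / _]mulrC.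
by rewrite -[t *+ k]mulr_natl mulKf// pnatr_eq0 -lt0n.
Qed.

Lemma sum_f1 k (x : 'I_k -> R) (h : R -> R) :
  (leb R).-integrable I01 (EFin \o h) ->
  \sum_(j < k) f1 h (x j) = \int[leb R]_(t in I01) (h t * \sum_(j < k) Kker (x j) t).
Proof.
move=> ih.
have iK j : (leb R).-integrable I01 (fun t => (h t * Kker (x j) t)%:E).
  apply: (integrable_mul_bounded (M := 1) ih (measurable_Kker (x j))) => t.
  exact: normr_Kker_le1.
apply: EFin_inj; rewrite -sumEFin.
transitivity (\sum_(j < k) \int[leb R]_(t in I01) (h t * Kker (x j) t)%:E)%E.
  apply: eq_bigr => j _; rewrite /f1 /Rintegral fineK//.
  exact: integrable_fin_num.
rewrite -integral_sum// /Rintegral.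
have -> : (\int[leb R]_(t in I01) \sum_(j < k) (h t * Kker (x j) t)%:E =
           \int[leb R]_(t in I01) (h t * \sum_(j < k) Kker (x j) t)%:E)%E.
  by apply: eq_integral => t _; rewrite sumEFin mulr_sumr.
rewrite fineK//; apply: integrable_fin_num => //.
apply: (integrable_mul_bounded (M := k%:R) ih (measurable_sum_Kker x)) => t.
exact: normr_sum_Kker_le.
Qed.

Lemma integrable_mul_disc k (x : 'I_k -> R) (h : R -> R) :
  (leb R).-integrable I01 (EFin \o h) ->
  (leb R).-integrable I01 (fun t => (h t * disc x t)%:E).
Proof.
move=> ih; apply: (integrable_mul_bounded (M := 1) ih (measurable_disc x)) => t.
exact: normr_disc_le1.
Qed.

(** Constants are integrated exactly and [f1 h] has integral 0, so the error is minus the average of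
    [f1 h] over the nodes. *)
Lemma QMC_error k (x : 'I_k -> R) (c : R) (h : R -> R) : (0 < k)%N ->
  measurable_fun setT h -> (leb R).-integrable I01 (EFin \o h) ->
  \int[leb R]_(y in I01) fF c h y - QMC x (fF c h) =
  - \int[leb R]_(t in I01) (h t * disc x t).
Proof.
move=> k0 mh ih; have [if1 f10] := f1_integral0 mh ih.
have -> : \int[leb R]_(y in I01) fF c h y = c.
  rewrite RintegralD//; last exact: (integrable_bounded01 (g := cst c) (M := `|c|)).
  rewrite f10 addr0 Rintegral_cst//.
  by rewrite leb01 mulr1.
have -> : QMC x (fF c h) = c + k%:R^-1 * \sum_(j < k) f1 h (x j).
  rewrite /QMC big_split/= sumr_const card_ord mulrDr -[c *+ k]mulr_natl mulKf//.
  by rewrite pnatr_eq0 -lt0n.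
rewrite opprD addNKr sum_f1// -RintegralZl//.
  by congr (- _); apply: eq_Rintegral => t _; rewrite /disc mulrCA.
apply: (integrable_mul_bounded (M := k%:R) ih (measurable_sum_Kker x)) => t.
exact: normr_sum_Kker_le.
Qed.

Lemma sum_nat_ltn (k i : nat) : (i <= k)%N -> (\sum_(j < k) (j < i))%N = i.
Proof.
move=> ik; transitivity (\sum_(j < k | (j < i)%N) 1)%N.
  by rewrite [RHS]big_mkcond; apply: eq_bigr => j _; case: ltnP.
by rewrite -(big_ord_widen k (fun=> 1%N) ik) sum1_card card_ord.
Qed.

(** On the cell between the consecutive nodes [(2 * i - 1) / (2 * k)] and [(2 * i + 1) / (2 * k)]
    exactly the nodes of index below [i] are less than [t]. The cell is open on the left and closed
    on the right because the count uses a strict inequality. *)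
Lemma disc_mid (k i : nat) (t : R) : (0 < k)%N -> (i <= k)%N ->
  2 * i%:R - 1 < 2 * k%:R * t <= 2 * i%:R + 1 ->
  disc (@mid_nodes R k) t = t - i%:R / k%:R.
Proof.
move=> k0 ik /andP[it ti]; rewrite discE//; congr (_ - _%:R / _).
rewrite -[RHS](sum_nat_ltn ik); apply: eq_bigr => j _; congr nat_of_bool.
have k0' : (0 : R) < 2 * k%:R by rewrite mulr_gt0// ltr0n.
rewrite /mid_nodes ltr_pdivrMr// mulrC [t * _]mulrC [_%:R * 2]mulrC.
have [ji|ij] := ltnP j i.
  apply: le_lt_trans it; have : (j.+1%:R : R) <= i%:R by rewrite ler_nat.
  by rewrite -natr1; lra.
apply/negbTE; rewrite -leNgt (le_trans ti)//.
have : (i%:R : R) <= j%:R by rewrite ler_nat.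
by lra.
Qed.

(** The upper inequality holds for [i = k]. The least [i] satisfying it also satisfies the lower
    one: a positive [i] violating it could be decreased, and for [i = 0] the lower bound is -1. *)
Lemma disc_mid_cell (k : nat) (t : R) : (0 < k)%N -> t \in `[(0:R), 1] ->
  exists2 i, (i <= k)%N & 2 * i%:R - 1 < 2 * k%:R * t <= 2 * i%:R + 1.
Proof.
rewrite in_itv/= => k0 /andP[t0 t1].
have k0' : (0 : R) < k%:R by rewrite ltr0n.
have ex : exists i, 2 * k%:R * t <= 2 * i%:R + 1 :> R.
  by exists k; nra.
case: (ex_minnP ex) => i ti mini; exists i.
  by apply: mini; nra.
rewrite ti andbT; case: i ti mini => [|i] ti mini; first by nra.
rewrite ltNge; apply/negP => H.
suff /mini : 2 * k%:R * t <= 2 * i%:R + 1 :> R by rewrite ltnn.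
by move: H; rewrite -natr1; lra.
Qed.

Lemma normr_disc_mid_le (k : nat) (t : R) : (0 < k)%N -> t \in `[(0:R), 1] ->
  `|disc (@mid_nodes R k) t| <= (2 * k%:R)^-1.
Proof.
move=> k0 tI; have [i ik it] := disc_mid_cell k0 tI.
rewrite (disc_mid k0 ik it).
have k0' : (0 : R) < k%:R by rewrite ltr0n.
have -> : t - i%:R / k%:R = (2 * k%:R)^-1 * (2 * k%:R * t - 2 * i%:R).
  by field; rewrite gt_eqF.
rewrite normrM ger0_norm ?invr_ge0 ?mulr_ge0// ler_piMr ?invr_ge0 ?mulr_ge0//.
by move/andP: it => [? ?]; rewrite ler_norml; apply/andP; split; lra.
Qed.

(* [disc x] and [disc mid_nodes] differ by an integer multiple of [1/k], and the
   latter is the representative of least absolute value. *)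
Lemma normr_disc_mid_min (k : nat) (x : 'I_k -> R) (t : R) : (0 < k)%N ->
  t \in `[(0:R), 1] -> `|disc (@mid_nodes R k) t| <= `|disc x t|.
Proof.
move=> k0 tI; have := normr_disc_mid_le k0 tI; rewrite !discE//.
set m := (\sum_(j < k) (x j < t)%R)%N; set i := (\sum_(j < k) _)%N.
have k0' : (0 : R) < k%:R by rewrite ltr0n.
have [->//|mi] := eqVneq i m.
have {mi} : 1 <= `|i%:R - m%:R| :> R.
  have [H|H] := leqP i m.
    rewrite -normrN opprB -natrB// normr_nat ler1n subn_gt0 ltn_neqAle mi//.
  by rewrite -natrB 1?ltnW// normr_nat ler1n subn_gt0.
have -> : t - m%:R / k%:R = (t - i%:R / k%:R) + (i%:R - m%:R) / k%:R.
  by field; rewrite gt_eqF.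
set a := t - _; set b := i%:R - _ => b1 al.
(* Here [|b| / k] is at least [1 / k] and [|a|] at most [1 / (2 * k)], so the difference on the left
   is still at least [|a|]. *)
have : `|b / k%:R| - `|a| <= `|a + b / k%:R|.
  by rewrite [a + _]addrC lerB_normD.
apply: le_trans; rewrite normrM [X in _ * X]ger0_norm ?invr_ge0//.
rewrite lerBrDr (le_trans (lerD al al))//.
rewrite invfM -mulrDl -[leLHS]mul1r [X in 1 * (X * _)](_ : _ = 1) ?mul1r; last by lra.
by rewrite ler_peMl// invr_ge0.
Qed.

End Discrepancy.

(** * Integrals of powers of the midpoint discrepancy *)

Section PowerIntegral.
Variable R : realType.
Local Notation I01 := (`[(0:R), 1]%classic).
Implicit Types a b q : R.

Lemma is_derive_powRB a q (x : R) : a < x ->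
  is_derive x (1 : R) (fun t : R => (t - a) `^ q) (q * (x - a) `^ (q - 1)).
Proof.
move=> ax; rewrite -[X in is_derive _ _ _ X]mulr1.
apply: (is_derive1_comp (f := fun y : R => y `^ q) (g := shift (- a))).
  by apply: is_derive1_powR; rewrite /= subr_gt0.
exact: is_derive_shift.
Qed.

Lemma continuous_powRB a q (x : R) : a < x ->
  {for x, continuous (fun t : R => (t - a) `^ q)}.
Proof.
move=> /(is_derive_powRB q)[dx _].
by apply: differentiable_continuous; apply/derivable1_diffP.
Qed.

Lemma within_continuous_powRB a b q : a < b -> 0 < q ->
  {within `[a, b], continuous (fun t => (t - a) `^ q)}.
Proof.
move=> ab q0; apply/continuous_within_itvP => //; split.
- by move=> x; rewrite in_itv/= => /andP[ax xb]; exact: continuous_powRB.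
- rewrite subrr powR0 ?gt_eqF//.
  (* At the left endpoint the power is known to tend to 0 only as its base decreases to 0, so the
     shift must be a limit from the right. *)
  have sa : t - a @[t --> a^'+] --> 0^'+.
    move=> A [e /= e0 HA]; exists e => // t /= ta at_.
    by apply: HA; rewrite /= ?subr_gt0// sub0r normrN distrC.
  exact: (@cvg_comp _ _ _ (fun t => t - a) (fun y => y `^ q) _ _ _ sa (powR_cvg0 q0)).
- apply: cvg_at_left_filter.
  by apply: continuous_powRB; rewrite ab.
Qed.

(** Fundamental theorem of calculus with the primitive (t - a)^(q + 1) / (q + 1), differentiable
    inside the interval and one-sidedly continuous at its ends. *)
Lemma integral_powRBl a b q : a < b -> 0 < q ->
  (\int[lebesgue_measure]_(t in `[a, b]) ((t - a) `^ q)%:E =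
   ((b - a) `^ (q + 1) / (q + 1))%:E)%E.
Proof.
move=> ab q0; have q1 : 0 < q + 1 by rewrite addr_gt0.
have [cF Fa Fb] := (continuous_within_itvP (fun t => (t - a) `^ (q + 1)) ab).1
  (within_continuous_powRB ab q1).
have dF x : a < x -> is_derive x (1 : R)
    (fun t => (q + 1)^-1 * (t - a) `^ (q + 1)) ((x - a) `^ q).
  move=> ax; have -> : (x - a) `^ q = (q + 1)^-1 *: ((q + 1) * (x - a) `^ q).
    by rewrite -[_ *: _]/(_ * _) mulKf// gt_eqF.
  apply: is_deriveZ; have := is_derive_powRB (q + 1) ax.
  by rewrite addrK.
rewrite (@continuous_FTC2 _ _ (fun t => (q + 1)^-1 * (t - a) `^ (q + 1)))//.
- by rewrite subrr powR0 ?gt_eqF// mulr0 sube0 mulrC.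
- exact: within_continuous_powRB.
- split.
  + by move=> x; rewrite in_itv/= => /andP[ax _]; have [] := dF _ ax.
  + by apply: cvgM => //; exact: cvg_cst.
  + by apply: cvgM => //; exact: cvg_cst.
- move=> x; rewrite in_itv/= => /andP[ax _]; rewrite derive1E.
  by have [_ ->] := dF _ ax.
Qed.

(** The reflection of [t] to [- t] reduces this to the previous integral on [-b, -a]. *)
Lemma integral_powRBr a b q : a < b -> 0 < q ->
  (\int[lebesgue_measure]_(t in `[a, b]) ((b - t) `^ q)%:E =
   ((b - a) `^ (q + 1) / (q + 1))%:E)%E.
Proof.
move=> ab q0; have nab : - b < - a by rewrite ltrN2.
have cG : {within `[(- b), (- a)], continuous (fun t : R => (t + b) `^ q)}.
  by have := within_continuous_powRB nab q0; rewrite opprK.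
have := integral_powRBl nab q0; rewrite opprK [- a + b]addrC => <-.
have -> := integration_by_substitution_oppr (ltW ab) cG.
by apply: eq_integral => t _ /=; rewrite addrC.
Qed.

Lemma measurable_normr_disc_powR k (x : 'I_k -> R) q :
  measurable_fun setT (fun t => `|disc x t| `^ q).
Proof.
apply: (measurableT_comp (measurable_powR q)).
exact: measurableT_comp (measurable_disc x).
Qed.

Lemma integral_disc_mid_powR (k : nat) q : (0 < k)%N -> 0 < q ->
  (\int[leb R]_(t in I01) (`|disc (@mid_nodes R k) t| `^ q)%:E =
   ((2 * k%:R)^-1 `^ q / (q + 1))%:E)%E.
Proof.
move=> k0 q0; pose f t := (`|disc (@mid_nodes R k) t| `^ q)%:E.
have k0' : (0 : R) < k%:R by rewrite ltr0n.
have k2 : (0 : R) < 2 * k%:R by rewrite mulr_gt0.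
have kK (y : R) : k%:R * (y / k%:R) = y by field; rewrite gt_eqF.
have k2K (y : R) : 2 * k%:R * (y / (2 * k%:R)) = y by field; rewrite gt_eqF.
have mf A : measurable_fun A f.
  apply: measurable_funTS; apply/measurable_EFinP.
  exact: measurable_normr_disc_powR.
have f0 x : (0 <= f x)%E by rewrite lee_fin powR_ge0.
(* Induction over the subintervals of length [1 / k]. Each is halved by its node, and the two halves
   contribute equally. *)
have main m : (m <= k)%N -> (\int[lebesgue_measure]_(t in `[0%R, (m%:R / k%:R)%R]) f t =
    (m%:R * (2 * ((2 * k%:R)^-1 `^ (q + 1) / (q + 1))))%:E)%E.
  elim: m => [_|m IH mk] /=.
    by rewrite mul0r mul0r set_itv1 integral_set1.
  (* The ends [u] and [v] are zeros of the discrepancy, and [c] is the node midway between them. *)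
  set u := (m%:R / k%:R) in IH *; pose c : R := (2 * m%:R + 1) / (2 * k%:R).
  set v := m.+1%:R / k%:R.
  have u0 : 0 <= u by rewrite divr_ge0.
  have cu : c - u = (2 * k%:R)^-1 by rewrite /c /u; field; rewrite gt_eqF.
  have vc : v - c = (2 * k%:R)^-1.
    by rewrite /c /v -natr1; field; rewrite gt_eqF.
  have k2i : 0 < (2 * k%:R)^-1 :> R by rewrite invr_gt0.
  have uc : u < c by rewrite -subr_gt0 cu.
  have cv : c < v by rewrite -subr_gt0 vc.
  have -> : `[0, v]%classic = `[0, u]%classic `|` (`]u, c]%classic `|` `]c, v]%classic) :> set R.
    rewrite -itv_bndbnd_setU ?bnd_simp ?ltW// -itv_bndbnd_setU ?bnd_simp//.
    by rewrite ltW// (lt_trans uc).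
  rewrite ge0_integral_setU//; last 3 first.
  - exact: measurableU.
  - exact: mf.
  - apply/disj_setPS => t /= []; rewrite !in_itv/= => /andP[_ tu].
    move=> [] /andP[]; first by rewrite ltNge tu.
    by rewrite ltNge (le_trans tu (ltW uc)).
  rewrite [X in (_ + X)%E]ge0_integral_setU//; last 2 first.
  - exact: mf.
  - apply/disj_setPS => t /= []; rewrite !in_itv/= => /andP[_ tu].
    by rewrite ltNge tu.
  (* Comparisons are scaled by [2 * k] to match the cells of [disc_mid] and to be linear in [m]. *)
  have cellE (y z : R) : (y <= z) = (2 * k%:R * y <= 2 * k%:R * z) by rewrite ler_pM2l.
  have cellE' (y z : R) : (y < z) = (2 * k%:R * y < 2 * k%:R * z) by rewrite ltr_pM2l.
  have uE : 2 * k%:R * u = 2 * m%:R by rewrite -mulrA kK.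
  have vE : 2 * k%:R * v = 2 * m%:R + 2 by rewrite -mulrA kK -[m.+1%:R]natr1; ring.
  have cE : 2 * k%:R * c = 2 * m%:R + 1 by rewrite k2K.
  have -> : (\int[lebesgue_measure]_(t in `]u, c]) f t =
      ((2 * k%:R)^-1 `^ (q + 1) / (q + 1))%:E)%E.
    have -> := integral_itv_obnd_cbnd (mf `]u, c]%classic).
    rewrite -cu; have <- := integral_powRBl uc q0.
    apply: eq_integral => t; rewrite mem_setE in_itv/= => /andP[ut tc].
    rewrite /f (disc_mid k0 (ltnW mk)); first by rewrite ger0_norm ?subr_ge0.
    by move: ut tc; rewrite (cellE u) (cellE t) uE cE => ut tc; apply/andP; split; lra.
  have -> : (\int[lebesgue_measure]_(t in `]c, v]) f t =
      ((2 * k%:R)^-1 `^ (q + 1) / (q + 1))%:E)%E.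
    have mg : measurable_fun `]c, v]%classic (fun t : R => ((v - t) `^ q)%:E).
      apply: measurable_funTS; apply/measurable_EFinP.
      apply: (measurableT_comp (measurable_powR q)).
      exact: measurable_funB.
    rewrite -vc; have <- := integral_powRBr cv q0.
    (* The left end has to be open here: the node [c] still belongs to cell [m], and [disc_mid] with
       index [m.+1] requires [c < t]. *)
    have <- := integral_itv_obnd_cbnd mg.
    apply: eq_integral => t; rewrite mem_setE in_itv/= => /andP[ct tv].
    rewrite /f (disc_mid k0 mk); first by rewrite ler0_norm ?subr_le0// opprB.
    move: ct tv; rewrite (cellE' c) (cellE t) vE cE -[m.+1%:R]natr1 => ct tv.
    by apply/andP; split; lra.
  have -> := IH (ltnW mk); rewrite -[m.+1%:R]natr1.
  have E (y z : R) : y * (2 * z) + (z + z) = (y + 1) * (2 * z) by ring.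
  exact: (congr1 EFin (E _ _)).
have := main k (leqnn k); rewrite divff ?gt_eqF// => E.
apply: (etrans E); congr EFin.
(* Splitting one factor [(2 * k)^-1] off the power cancels the number [2 * k] of half cells. *)
rewrite powRD; last by rewrite gt_eqF// addr_gt0.
rewrite powRr1 ?invr_ge0 ?ltW//; field.
by rewrite !gt_eqF//; lra.
Qed.

End PowerIntegral.

(** * The norm of F_1 and the norms of the midpoint discrepancy *)

Section Norm.
Variable R : realType.
Local Notation I01 := (`[(0:R), 1]%classic).

Lemma conj_factor1 : conj_factor (1%E : \bar R) = 1.
Proof. by rewrite /conj_factor hoelder_conjugate1. Qed.

Lemma conj_factor_infty : conj_factor (+oo%E : \bar R) = 2.
Proof. by rewrite /conj_factor /= invr1 powRr1. Qed.

Lemma conj_factor_ge0 (p : \bar R) : 0 <= conj_factor p.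
Proof. by rewrite /conj_factor; case: hoelder_conjugate => [q| |]//; exact: powR_ge0. Qed.

Lemma conj_factor_EFin (r : R) : 1 < r ->
  conj_factor r%:E = (r / (r - 1) + 1) `^ (r / (r - 1))^-1.
Proof.
move=> r1; rewrite /conj_factor /hoelder_conjugate/=.
by rewrite gt_eqF ?lte_fin ?(lt_trans ltr01)// -EFinB inver subr_eq0 gt_eqF.
Qed.

(** The test functions of the lower bound have no constant part, so only the norm of [h] constrains
    them. *)
Lemma normF1_pure (p : \bar R) (g0 g1 : R) (h : R -> R) : (1 <= p)%E ->
  normF1 p g0 g1 0 h = w1 p g1 h.
Proof.
have w00 : w0 g0 0 = 0%E by rewrite /w0 normr0 mul0r; case: ifP.
have w10 s : (0 <= w1 s g1 h)%E.
  rewrite /w1; case: ifPn => // g10; apply: mule_ge0; first exact: Lnorm_ge0.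
  by rewrite lee_fin invr_ge0 ltW.
case: p => [r| |]//=; last by rewrite w00 => _; rewrite max_r.
rewrite lee_fin => r1; have r0 : r != 0 by rewrite gt_eqF// (lt_le_trans ltr01).
by rewrite w00 poweR0r// add0e -poweRrM mulfV// poweRe1.
Qed.

(** Used for the upper bound: dropping the nonnegative term of the constant leaves a bound on [h]
    alone. *)
Lemma w1_le_normF1 (p : \bar R) (g0 g1 c : R) (h : R -> R) : (1 <= p)%E ->
  (w1 p g1 h <= normF1 p g0 g1 c h)%E.
Proof.
have w10 s : (0 <= w1 s g1 h)%E.
  rewrite /w1; case: ifPn => // g10; apply: mule_ge0; first exact: Lnorm_ge0.
  by rewrite lee_fin invr_ge0 ltW.
case: p => [r| |]//=; last by rewrite le_max lexx orbT.
rewrite lee_fin => r1; have r0 : 0 < r by rewrite (lt_le_trans ltr01).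
have {1}-> : w1 r%:E g1 h = ((w1 r%:E g1 h `^ r) `^ r^-1)%E.
  by rewrite -poweRrM mulfV ?gt_eqF// poweRe1.
apply: gt0_ler_poweR; first by rewrite invr_ge0 ltW.
- by rewrite in_itv/= poweR_ge0 leey.
- by rewrite in_itv/= adde_ge0 ?poweR_ge0// leey.
- by rewrite leeDr// poweR_ge0.
Qed.

Lemma Lnorm_powR_disc (k : nat) (q : R) : (0 < k)%N -> 0 < q ->
  'N[@mu01 R]_q%:E[EFin \o disc (@mid_nodes R k)]%E =
  ((2 * k%:R)^-1 / (q + 1) `^ q^-1)%:E.
Proof.
move=> k0 q0; rewrite unlock /=.
have k2 : 0 <= (2 * k%:R)^-1 :> R by rewrite invr_ge0 mulr_ge0.
rewrite integral_mu01; last 2 first.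
- by apply/measurable_EFinP; exact: measurable_normr_disc_powR.
- by move=> t; rewrite lee_fin powR_ge0.
have -> := integral_disc_mid_powR k0 q0.
rewrite poweR_EFin powRM ?powR_ge0 ?invr_ge0 ?addr_ge0 ?(ltW q0)//.
rewrite -powRrM mulfV ?gt_eqF// powRr1//.
by rewrite -[X in X `^ _]powR_inv1 ?addr_ge0 ?(ltW q0)// -powRrM mulN1r powRN.
Qed.

End Norm.

(** * Lower bounds for arbitrary rules *)

Section LowerBound.
Variable R : realType.
Local Notation I01 := (`[(0:R), 1]%classic).

(* The test function is [phi] with the sign of [disc x]. *)
Lemma wce_ge_integral (p : \bar R) (g0 g1 : R) k (x : 'I_k -> R) (phi : R -> R) :
  (1 <= p)%E -> 0 < g1 -> (0 < k)%N -> measurable_fun setT phi ->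
  (forall t, 0 <= phi t) -> ('N[@mu01 R]_p[EFin \o phi] <= g1%:E)%E ->
  (\int[leb R]_(t in I01) (phi t * `|disc (@mid_nodes R k) t|)%:E
     <= wce p g0 g1 x)%E.
Proof.
move=> p1 g10 k0 mphi phi0 Nphi.
pose h t := if 0 <= disc x t then phi t else - phi t.
have mh : measurable_fun setT h.
  apply: measurable_fun_ifT => //; last exact: measurableT_comp.
  by apply: measurable_fun_ler => //; exact: measurable_disc.
(* The sign change does not affect the norm, which depends only on the modulus. *)
have Nh : ('N[@mu01 R]_p[EFin \o h] <= g1%:E)%E.
  apply: le_trans Nphi; rewrite -Lnorm_abse -[leRHS]Lnorm_abse.
  suff -> : abse \o (EFin \o h) = abse \o (EFin \o phi) by [].
  by apply/funext => t; rewrite /= /h; case: ifP => // _; rewrite normrN.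
have fh : finite_norm (@mu01 R) p h by rewrite /finite_norm (le_lt_trans Nh)// ltry.
have ih := integrable_Lp p1 mh fh.
have hE t : h t * disc x t = phi t * `|disc x t|.
  rewrite /h; case: leP => d0; first by rewrite ger0_norm.
  by rewrite ltr0_norm// mulrN mulNr.
have iD := integrable_mul_disc x ih.
apply: (@le_trans _ _ (`| \int[leb R]_(y in I01) fF 0 h y - QMC x (fF 0 h) |)%:E).
  rewrite QMC_error// normrN.
  (* Pointwise minimality of the midpoint discrepancy enters here and makes the bound independent of
     the nodes [x]. *)
  apply: (@le_trans _ _ (\int[leb R]_(t in I01) (h t * disc x t)%:E)%E).
    apply: ge0_le_integral => //.
    - by move=> t _; rewrite lee_fin mulr_ge0.
    - apply: measurable_funTS; apply/measurable_EFinP; apply: measurable_funM => //.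
      exact: measurableT_comp (measurable_disc _).
    - apply: measurable_funTS; apply/measurable_EFinP; apply: measurable_funM => //.
      exact: measurable_disc.
    - by move=> t tI; rewrite hE lee_fin ler_wpM2l// normr_disc_mid_min.
  rewrite -[X in (X <= _)%E]fineK; last exact: integrable_fin_num.
  by rewrite lee_fin ler_norm.
apply: ereal_sup_ubound; exists 0, h; split => //.
  by split => // g1E; rewrite g1E ltxx in g10.
by rewrite normF1_pure// /w1 g10 lee_pdivrMr// mul1e.
Qed.

Lemma wce_ge0 (p : \bar R) (g0 g1 : R) k (x : 'I_k -> R) : (1 <= p)%E ->
  (0 <= wce p g0 g1 x)%E.
Proof.
move=> p1; have p0 : p != 0%E by rewrite gt_eqF// (lt_le_trans lte01).
have N0 : 'N[@mu01 R]_p[EFin \o (cst 0%R : R -> R)]%E = 0%E by exact: Lnorm0.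
apply: (@le_trans _ _ (`| \int[leb R]_(y in I01) fF 0 (cst 0) y - QMC x (fF 0 (cst 0)) |)%:E).
  by rewrite lee_fin.
apply: ereal_sup_ubound; exists 0, (cst 0); split => //.
  by split => //; rewrite /finite_norm N0 ltry.
by rewrite normF1_pure// /w1 N0 mul0e; case: ifP.
Qed.

(** Equality in Hoelder's inequality holds for a modulus proportional to |D|^(q - 1), where [D] is
    the midpoint discrepancy and [q] is conjugate to [r]. *)
Lemma wce_ge_powR (r g0 g1 : R) k (x : 'I_k -> R) :
  1 < r -> 0 < g1 -> (0 < k)%N ->
  ((g1 / (2 * conj_factor r%:E * k%:R))%:E <= wce r%:E g0 g1 x)%E.
Proof.
move=> r1 g10 k0; rewrite conj_factor_EFin//.
have r0 : 0 < r by rewrite (lt_trans ltr01).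
have rB0 : 0 < r - 1 by rewrite subr_gt0.
set q := r / (r - 1); have q0 : 0 < q by rewrite divr_gt0.
have q10 : 0 < q + 1 by rewrite addr_gt0.
have k0' : (0 : R) < k%:R by rewrite ltr0n.
have k20 : 0 < (2 * k%:R)^-1 :> R by rewrite invr_gt0 mulr_gt0.
(* [S] is the integral of |D|^q. Since r (q - 1) = q, the factor [l] below gives the test function
   norm [g1], and its pairing with |D| is l S = g1 S^(1/q). *)
pose S : R := (2 * k%:R)^-1 `^ q / (q + 1).
have S0 : 0 < S by rewrite divr_gt0// powR_gt0.
pose l := g1 / S `^ r^-1.
have l0 : 0 < l by rewrite divr_gt0// powR_gt0.
pose D := disc (@mid_nodes R k).
have mD s : measurable_fun setT (fun t => `|D t| `^ s).
  exact: measurable_normr_disc_powR.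
have -> : g1 / (2 * (q + 1) `^ q^-1 * k%:R) = l * S.
  have -> : l * S = g1 * S `^ q^-1.
    rewrite /l -mulrA; congr (_ * _); rewrite mulrC -[X in X / _]powRr1 ?ltW//.
    rewrite -powRB ?(gt_eqF S0) ?implybT//; congr (_ `^ _).
    by rewrite /q; field; rewrite !gt_eqF.
  rewrite /S powRM ?powR_ge0 ?invr_ge0 ?(ltW q10)//.
  rewrite -powRrM mulfV ?gt_eqF// powRr1 ?ltW//.
  rewrite -[(q + 1)^-1]powR_inv1 ?(ltW q10)// -powRrM mulN1r powRN.
  by rewrite !invfM; ring.
have lE : l * S `^ r^-1 = g1 by rewrite /l divfK// gt_eqF// powR_gt0.
clearbody l.
apply: le_trans (wce_ge_integral (phi := fun t => l * `|D t| `^ (q - 1)) g0 x _ g10 k0 _ _ _).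
- have -> : (\int[leb R]_(t in I01) (l * `|D t| `^ (q - 1) * `|D t|)%:E =
     \int[leb R]_(t in I01) (l%:E * (`|D t| `^ q)%:E))%E.
    apply: eq_integral => t _; congr EFin.
    by rewrite -mulrA [_ * `|D t|]mulrC mulr_powRB1.
  rewrite ge0_integralZl_EFin ?(ltW l0)//; last first.
    by apply: measurable_funTS; apply/measurable_EFinP; exact: mD.
  by have -> := integral_disc_mid_powR k0 q0.
- by rewrite lee_fin ltW.
- by apply: measurable_funM => //; exact: mD.
- by move=> t; rewrite mulr_ge0 ?powR_ge0// ltW.
- rewrite unlock /=.
  have -> : (\int[@mu01 R]_t (`|l * `|D t| `^ (q - 1)| `^ r)%:E =
     \int[@mu01 R]_t ((l `^ r)%:E * (`|D t| `^ q)%:E))%E.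
    apply: eq_integral => t _; congr EFin.
    rewrite ger0_norm ?mulr_ge0 ?powR_ge0 ?(ltW l0)//.
    rewrite powRM ?powR_ge0 ?(ltW l0)//; congr (_ * _).
    by rewrite -powRrM; congr (_ `^ _); rewrite /q; field; rewrite gt_eqF.
  rewrite ge0_integralZl_EFin ?powR_ge0//; last by apply/measurable_EFinP; exact: mD.
  rewrite integral_mu01//; last by apply/measurable_EFinP; exact: mD.
  have -> := integral_disc_mid_powR k0 q0.
  rewrite -EFinM poweR_EFin powRM ?powR_ge0 ?(ltW S0)//.
  rewrite -powRrM mulfV ?gt_eqF// powRr1 ?(ltW l0)//.
  by rewrite lE.
Qed.

Lemma integral_disc_mid (k : nat) : (0 < k)%N ->
  (\int[leb R]_(t in I01) (`|disc (@mid_nodes R k) t|)%:E =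
   ((2 * k%:R)^-1 / 2)%:E)%E.
Proof.
move=> k0; have := integral_disc_mid_powR k0 (@ltr01 R).
rewrite powRr1 ?invr_ge0 ?mulr_ge0// => <-.
by apply: eq_integral => t _; rewrite powRr1.
Qed.

(** For infinite [p] the constant modulus [g1] is extremal, and the bound is [g1] times the L_1 norm
    of the midpoint discrepancy. *)
Lemma wce_ge_infty (g0 g1 : R) k (x : 'I_k -> R) : 0 < g1 -> (0 < k)%N ->
  ((g1 / (2 * conj_factor (+oo%E : \bar R) * k%:R))%:E <= wce +oo g0 g1 x)%E.
Proof.
move=> g10 k0; rewrite conj_factor_infty.
have k0' : (0 : R) < k%:R by rewrite ltr0n.
apply: le_trans (wce_ge_integral (phi := cst g1) g0 x _ g10 k0 _ _ _).
- have -> : (\int[leb R]_(t in I01) (cst g1 t * `|disc (@mid_nodes R k) t|)%:E =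
     \int[leb R]_(t in I01) (g1%:E * (`|disc (@mid_nodes R k) t|)%:E))%E by [].
  rewrite ge0_integralZl_EFin ?(ltW g10)//; last first.
    apply: measurable_funTS; apply/measurable_EFinP.
    exact: measurableT_comp (measurable_disc _).
  rewrite integral_disc_mid// -EFinM lee_fin.
  suff -> : g1 / (2 * 2 * k%:R) = g1 * ((2 * k%:R)^-1 / 2) by [].
  by field; rewrite gt_eqF.
- by rewrite leey.
- exact: measurable_cst.
- by move=> t; exact: ltW.
- have T0 : (0 < @mu01 R [set: R])%E by rewrite mu01T lte01.
  rewrite unlock; case: ifPn => [_|_]; last by rewrite lee_fin ltW.
  suff -> : ess_sup (@mu01 R) (abse \o (EFin \o cst g1)) = g1%:E by [].
  apply: ess_sup_ae_cst; first exact: T0.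
  by apply: nearW => t /=; rewrite ger0_norm// ltW.
Qed.

(** For [p = 1] the maximum of the midpoint discrepancy is attained only at isolated points. The
    mass [g1] is therefore concentrated on a short interval ending at the first node [b], where the
    discrepancy equals [t], and the bound is reached up to any [d > 0]. *)
Lemma wce_ge_one (g0 g1 : R) k (x : 'I_k -> R) : 0 < g1 -> (0 < k)%N ->
  ((g1 / (2 * conj_factor (1%E : \bar R) * k%:R))%:E <= wce 1 g0 g1 x)%E.
Proof.
move=> g10 k0; rewrite conj_factor1 mulr1.
have k0' : (0 : R) < k%:R by rewrite ltr0n.
have k1 : 1 <= k%:R :> R by rewrite ler1n.
pose b : R := (2 * k%:R)^-1.
have b0 : 0 < b by rewrite invr_gt0 mulr_gt0.
have kb : 2 * k%:R * b = 1 by rewrite mulfV// gt_eqF// mulr_gt0.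
have b1 : b <= 1 by rewrite invf_le1 ?mulr_gt0//; lra.
apply/lee_subgt0Pr => d d0.
(* The first term keeps the loss [g1 * e] below [d]; the second keeps the interval [[b - e, b]]
   inside [0,1]. *)
pose e := Num.min (d / g1) (b / 2).
have e0 : 0 < e by rewrite lt_min !divr_gt0.
have eb : e < b.
  by rewrite gt_min; apply/orP; right; rewrite ltr_pdivrMr// ltr_pMr// ltr1n.
have ed : g1 * e <= d.
  by rewrite mulrC -ler_pdivlMr// ge_min lexx.
pose B := `[b - e, b]%classic : set R.
have measB : measurable B by exact: measurable_itv.
have mB : measurable_fun setT (\1_B : R -> R) by exact: measurable_indic.
have int_B (C : R) : 0 <= C ->
    (\int[leb R]_(t in I01) (C * \1_B t)%:E = (C * e)%:E)%E.
  move=> C0.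
  have -> : (\int[leb R]_(t in I01) (C * \1_B t)%:E =
     \int[leb R]_(t in I01) (C%:E * (\1_B t)%:E))%E by [].
  rewrite ge0_integralZl_EFin//; last by apply: measurable_funTS; exact/measurable_EFinP.
  rewrite integral_indic//.
  have -> : B `&` I01 = B.
    apply/setIidl => t; rewrite /B /= !in_itv/= => /andP[bt tb].
    by apply/andP; split; lra.
  have := @lebesgue_measure_itv R `[b - e, b].
  rewrite /= lte_fin ltrBlDr ltrDl e0 => ->.
  by rewrite -EFinB -EFinM; congr (_ * _)%:E; ring.
apply: le_trans (wce_ge_integral (phi := fun t => g1 / e * \1_B t) g0 x _ g10 k0 _ _ _) => //.
(* On [B] the discrepancy is at least its value [b - e] at the left end. *)
- apply: (@le_trans _ _ (\int[leb R]_(t in I01) (g1 / e * (b - e) * \1_B t)%:E)%E).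
    rewrite int_B; last by rewrite mulr_ge0 ?divr_ge0 ?ltW// subr_gt0.
    rewrite -EFinB lee_fin.
    have -> : g1 / e * (b - e) * e = g1 * b - g1 * e by field; rewrite gt_eqF.
    by rewrite lerB.
  apply: ge0_le_integral => //.
  + move=> t _; rewrite lee_fin mulr_ge0//; apply: mulr_ge0.
      by rewrite divr_ge0 ?ltW.
    by rewrite subr_ge0 ltW.
  + apply: measurable_funTS; apply/measurable_EFinP; exact: measurable_funM.
  + apply: measurable_funTS; apply/measurable_EFinP.
    apply: measurable_funM; first exact: measurable_funM.
    exact: measurableT_comp (measurable_disc _).
  + move=> t _; rewrite lee_fin indicE mem_setE.
    case: (boolP (t \in `[b - e, b])) => tB; last by rewrite !mulr0 mul0r.
    rewrite !mulr1 ler_wpM2l ?divr_ge0 ?(ltW e0) ?(ltW g10)//.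
    move: tB; rewrite in_itv/= => /andP[bt tb].
    have t0 : 0 <= 2 * k%:R * t by rewrite !mulr_ge0//; lra.
    have t1 : 2 * k%:R * t <= 2 * k%:R * b by rewrite ler_wpM2l// mulr_ge0.
    rewrite (disc_mid (i := 0) k0 (leq0n k)); last by apply/andP; split; lra.
    by rewrite mul0r subr0 ger0_norm//; lra.
- exact: measurable_funM.
- by move=> t; rewrite mulr_ge0// divr_ge0 ?ltW.
- rewrite Lnorm1 integral_mu01//; last first.
    by apply: measurableT_comp => //; apply/measurable_EFinP; exact: measurable_funM.
  have -> : (\int[leb R]_(t in I01) `|(EFin \o (fun s => (g1 / e * \1_B s)%R)) t| =
    \int[leb R]_(t in I01) (g1 / e * \1_B t)%:E)%E.
    by apply: eq_integral => t _ /=; rewrite ger0_norm// mulr_ge0// divr_ge0 ?ltW.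
  by rewrite int_B ?divfK ?gt_eqF// divr_ge0 ?ltW.
Qed.

End LowerBound.

(** * Upper bound for the midpoint rule *)

Section UpperBound.
Variable R : realType.
Local Notation I01 := (`[(0:R), 1]%classic).

Lemma measurable_mul_disc k (x : 'I_k -> R) (h : R -> R) :
  measurable_fun setT h -> measurable_fun setT (fun t => (h t * disc x t)%:E).
Proof.
move=> mh; apply/measurable_EFinP; apply: measurable_funM => //.
exact: measurable_disc.
Qed.

Lemma integral_mul_disc_mid_le (p : \bar R) (n : nat) (h : R -> R) :
  (1 <= p)%E -> (0 < n)%N -> measurable_fun setT h ->
  finite_norm (@mu01 R) p h ->
  (`|\int[leb R]_(t in I01) (h t * disc (@mid_nodes R n) t)|%:E <=
   'N[@mu01 R]_p[EFin \o h] * (1 / (2 * conj_factor p * n%:R))%:E)%E.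
Proof.
move=> p1 n0 mh fh; have ih := integrable_Lp p1 mh fh.
have n0' : (0 : R) < n%:R by rewrite ltr0n.
pose D := disc (@mid_nodes R n).
have mhD := measurable_mul_disc (@mid_nodes R n) mh.
have mahD : measurable_fun setT (fun t => `|(h t * D t)%:E|%E).
  exact: measurableT_comp mhD.
have iD := integrable_mul_disc (@mid_nodes R n) ih.
have -> : (`|\int[leb R]_(t in I01) (h t * D t)|%:E =
    `|\int[leb R]_(t in I01) (h t * D t)%:E|)%E.
  by rewrite -[in RHS](fineK (integrable_fin_num _ iD)).
apply: (@le_trans _ _ (\int[leb R]_(t in I01) `|(h t * D t)%:E|)%E).
  by apply: le_abse_integral => //; exact: measurable_funTS.
(* For [p = 1] the uniform bound [1 / (2 * n)] on the discrepancy is used, for [1 < p < +oo]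
   Hoelder's inequality, and for [p = +oo] the almost everywhere bound of [|h|] by its norm. *)
case: p p1 fh => [r| |]//.
- rewrite lee_fin le_eqVlt => /predU1P[<-|r1] fh.
    rewrite conj_factor1 mulr1 Lnorm1 integral_mu01//; last first.
      by apply: measurableT_comp => //; exact/measurable_EFinP.
    have mah : measurable_fun setT (fun t => `|(h t)%:E|%E).
      by apply: measurableT_comp => //; exact/measurable_EFinP.
    rewrite -ge0_integralZr//; last exact: measurable_funTS.
    apply: ge0_le_integral => //.
    + exact: measurable_funTS.
    + by apply: emeasurable_funM; [exact: measurable_funTS|exact: measurable_cst].
    move=> t tI; rewrite /= -EFinM lee_fin normrM ler_wpM2l// div1r.
    exact: normr_disc_mid_le.
  rewrite conj_factor_EFin//.
  have r0 : 0 < r by rewrite (lt_trans ltr01).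
  have q0 : 0 < r / (r - 1) by rewrite divr_gt0// subr_gt0.
  rewrite -integral_mu01// -(Lnorm1 (@mu01 R) (fun t => (h t * D t)%:E)).
  apply: (le_trans (hoelder (@mu01 R) mh (measurable_disc (@mid_nodes R n)) r0 q0 _)).
    by field; rewrite !gt_eqF// subr_gt0.
  rewrite Lnorm_powR_disc//.
  suff -> : (2 * n%:R)^-1 / (r / (r - 1) + 1) `^ (r / (r - 1))^-1 =
    1 / (2 * (r / (r - 1) + 1) `^ (r / (r - 1))^-1 * n%:R) by [].
  by rewrite !invfM; ring.
- move=> _ fh; rewrite conj_factor_infty.
  have N0 := Lnorm_ge0 (@mu01 R) +oo (EFin \o h).
  set N := ('N[_]_+oo[_])%E in fh N0 *.
  have aeN : {ae @mu01 R, forall t, (`|(h t)%:E| <= N)%E}.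
    rewrite /N unlock; have T0 : (0 < @mu01 R [set: R])%E by rewrite mu01T lte01.
    case: ifPn => [_|]; last by rewrite T0.
    exact: ess_sup_ge.
  have mD : measurable_fun setT (fun t => `|D t|%:E).
    apply/measurable_EFinP; exact: measurableT_comp (measurable_disc _).
  rewrite -integral_mu01//.
  apply: (@le_trans _ _ (\int[@mu01 R]_t (N * `|D t|%:E))%E).
    apply: ae_ge0_le_integral => //.
    + by move=> t _; rewrite mule_ge0// lee_fin.
    + by apply: emeasurable_funM.
    case: aeN => A [mA A0 sub]; exists A; split => // t nhD; apply: sub => /= ht.
    apply: nhD => _.
    rewrite EFinM abseM -[`|D t|%:E]/(`|(D t)%:E|)%E.
    by apply: lee_wpmul2r.
  rewrite ge0_integralZl// integral_mu01// integral_disc_mid//.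
  suff -> : (2 * n%:R)^-1 / 2 = 1 / (2 * 2 * n%:R) :> R by [].
  by field; rewrite gt_eqF.
Qed.

Lemma wce_mid_le (p : \bar R) (g0 g1 : R) (n : nat) :
  (1 <= p)%E -> 0 <= g1 -> (0 < n)%N ->
  (wce p g0 g1 (@mid_nodes R n) <= (g1 / (2 * conj_factor p * n%:R))%:E)%E.
Proof.
move=> p1 g10 n0; apply: ge_ereal_sup => _ [c [h [[mh fh _ h0] hN ->]]].
have ih := integrable_Lp p1 mh fh.
rewrite QMC_error// normrN.
(* For zero weight the norm says nothing about [h]; membership in F_1 makes [h] vanish on [0,1]
   instead. *)
have [g1E|g1N] := eqVneq g1 0.
  rewrite g1E mul0r [X in `|X|](_ : _ = 0) ?normr0//.
  rewrite /Rintegral integral0_eq// => t tI.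
  by rewrite h0// mul0r.
have {g10 g1N} g10 : 0 < g1 by rewrite lt_neqAle eq_sym g1N.
have := le_trans (w1_le_normF1 g0 g1 c h p1) hN.
rewrite /w1 g10 lee_pdivrMr// mul1e => Nh.
apply: (le_trans (integral_mul_disc_mid_le p1 n0 mh fh)).
have C0 := conj_factor_ge0 p.
apply: (@le_trans _ _ (g1%:E * (1 / (2 * conj_factor p * n%:R))%:E)%E).
  by rewrite lee_wpmul2r// lee_fin divr_ge0// !mulr_ge0.
by rewrite -EFinM mulrA mulr1.
Qed.

End UpperBound.

(** * Exact error and optimality of the midpoint rule *)

Lemma wce_ge_conj_factor (R : realType) (p : \bar R) (g0 g1 : R) k (x : 'I_k -> R) :
  (1 <= p)%E -> 0 <= g1 -> (0 < k)%N ->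
  ((g1 / (2 * conj_factor p * k%:R))%:E <= wce p g0 g1 x)%E.
Proof.
move=> p1 g10 k0; have [->|g1N] := eqVneq g1 0.
  by rewrite mul0r; exact: wce_ge0.
have {g10 g1N} g10 : 0 < g1 by rewrite lt_neqAle eq_sym g1N.
case: p p1 => [r| |]//; last by move=> _; exact: wce_ge_infty.
rewrite lee_fin le_eqVlt => /predU1P[<-|r1]; first exact: wce_ge_one.
exact: wce_ge_powR.
Qed.

Theorem mainTheorem6 (R : realType) (p : \bar R) (g0 g1 : R) (n : nat) :
  (1 <= p)%E -> 0 <= g0 -> 0 <= g1 -> (0 < n)%N ->
  wce p g0 g1 (@mid_nodes R n) = (g1 / (2 * conj_factor p * n%:R))%:E /\
  (forall (k : nat) (x : 'I_k -> R),
     (0 < k <= n)%N -> (forall j, 0 <= x j <= 1) ->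
     (wce p g0 g1 (@mid_nodes R n) <= wce p g0 g1 x)%E).
Proof.
move=> p1 _ g10 n0; split=> [|k x /andP[k0 kn] _].
  (* The lower bound for all rules, applied to the midpoint rule itself, matches its upper bound. *)
  by apply/eqP; rewrite eq_le wce_mid_le// wce_ge_conj_factor.
apply: (le_trans (wce_mid_le g0 p1 g10 n0)); apply: le_trans (wce_ge_conj_factor g0 x p1 g10 k0).
have C0 := conj_factor_ge0 p.
rewrite lee_fin ler_wpM2l// !invfM ler_wpM2l ?mulr_ge0 ?invr_ge0//.
by rewrite lef_pV2 ?posrE ?ltr0n// ler_nat.
Qed.
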